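(* Let $n\ge 2$, $T=\mathbb{R}^{2n}$, and let $f$ be a differential operator on $(\Lambda^*T)^{\mathrm{SU}(n)}$ that extends to a derivation of degree one on $\Lambda^*T$. Then either $f=0$, or $n=3$ and there are real constants $\lambda,\mu$ such that \[f(F)=\lambda\,\Omega^+ +\mu\,\Omega^-,\quad f(\Omega^+)=\tfrac23\mu F^2,\quad f(\Omega^-)=-\tfrac23\lambda F^2.\]
   Context: $T=\mathbb{R}^{2n}$ has orthonormal basis $e^1,\dots,e^{2n}$ and is identified with its dual. $\mathrm{SU}(n)$ is the subgroup of $\mathrm{O}(2n)$ fixing \[F=e^{12}+\dots+e^{2n-1,2n},\qquad \Omega=\Omega^++i\Omega^-=(e^1+ie^2)\wedge\dots\wedge(e^{2n-1}+ie^{2n}),\] with $\Omega^\pm$ real, $e^{ij}=e^i\wedge e^j$, $F^2=F\wedge F$. $(\Lambda^*T)^{\mathrm{SU}(n)}$ is the algebra of invariant forms (generated by $F,\Omega^+,\Omega^-$). A differential operator on a graded subalgebra $A$ of $\Lambda^*T$ is a linear map $f\colon A\to A$ raising degree by one, satisfying the graded Leibniz rule and $f^2=0$. A derivation of degree one of $\Lambda^*T$ satisfies the graded Leibniz rule but need not square to zero. *)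

(* Defs.v *)
From HB Require Import structures.
From mathcomp Require Import all_boot all_order all_algebra.
From mathcomp Require Import boolp reals.
From mathcomp.real_closed Require Import complex.

Set Implicit Arguments.
Unset Strict Implicit.
Unset Printing Implicit Defensive.

Import Order.TTheory GRing.Theory Num.Theory.
Local Open Scope ring_scope.

(* The exterior algebra of K^m, with basis e^I = e^{i_1} /\ ... /\ e^{i_p},
   I = {i_1 < ... < i_p}: a form is the family of its coefficients. The ring
   product is the wedge product, not the pointwise one. *)
Definition ext (K : comNzRingType) (m : nat) : Type := {ffun {set 'I_m} -> K^o}.

HB.instance Definition _ (K : comNzRingType) (m : nat) :=
  GRing.Lmodule.copy (ext K m) {ffun {set 'I_m} -> K^o}.
HB.instance Definition _ (K : comNzRingType) (m : nat) :=
  Vector.copy (ext K m) {ffun {set 'I_m} -> K^o}.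

Section Wedge.
Variables (K : comNzRingType) (m : nat).
Implicit Types (a b c : ext K m) (I J U S : {set 'I_m}).

Definition ebase I : ext K m := [ffun S => (S == I)%:R].

Definition inversions I J : nat :=
  (\sum_(i in I) \sum_(j in J) (j < i))%N.

Definition wedge_base I J : ext K m :=
  if [disjoint I & J] then (-1) ^+ inversions I J *: ebase (I :|: J) else 0.

Definition wedge a b : ext K m :=
  \sum_I \sum_J (a I * b J) *: wedge_base I J.

Lemma extD a b S : (a + b) S = a S + b S.
Proof. by rewrite ffunE. Qed.

Lemma extZ (k : K) a S : (k *: a) S = k * a S.
Proof. by rewrite ffunE. Qed.

Lemma ext_sum (T : Type) (r : seq T) (P : pred T) (F : T -> ext K m) S :
  (\sum_(t <- r | P t) F t) S = \sum_(t <- r | P t) F t S.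
Proof. by rewrite sum_ffunE. Qed.

Lemma extE a : a = \sum_I a I *: ebase I.
Proof.
apply/ffunP => S; rewrite ext_sum (bigD1 S) //= extZ ffunE eqxx mulr1.
by rewrite big1 ?addr0 // => I nIS; rewrite extZ ffunE eq_sym (negPf nIS) mulr0.
Qed.

Lemma wedge_baseE I J S :
  wedge_base I J S =
  (if [disjoint I & J] && (S == I :|: J) then (-1) ^+ inversions I J else 0).
Proof.
rewrite /wedge_base; case: ifP => //= _; last by rewrite ffunE.
by rewrite extZ ffunE; case: eqP; rewrite ?mulr1 ?mulr0.
Qed.

Lemma wedgeE a b S :
  wedge a b S = \sum_I \sum_J a I * b J * wedge_base I J S.
Proof.
by rewrite ext_sum; apply: eq_bigr => I _; rewrite ext_sum;
   apply: eq_bigr => J _; rewrite extZ.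
Qed.

Lemma inversionsUl I J U : [disjoint I & J] ->
  inversions (I :|: J) U = (inversions I U + inversions J U)%N.
Proof.
by move=> dIJ; rewrite /inversions -bigU //=; apply: eq_bigl => i; rewrite !inE.
Qed.

Lemma inversionsUr I J U : [disjoint J & U] ->
  inversions I (J :|: U) = (inversions I J + inversions I U)%N.
Proof.
move=> dJU; rewrite /inversions -big_split /=.
by apply: eq_bigr => i _; rewrite -bigU //; apply: eq_bigl => j; rewrite !inE.
Qed.

Lemma wedge_baseA I J U S :
  \sum_V wedge_base J U V * wedge_base I V S =
  \sum_V wedge_base I J V * wedge_base V U S.
Proof.
have disjU (A B C : {set 'I_m}) :
    [disjoint A & B :|: C] = [disjoint A & B] && [disjoint A & C].
  by rewrite -!setI_eq0 setIUr setU_eq0.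
rewrite (bigD1 (J :|: U)) //= [X in _ + X]big1 ?addr0; last first.
  by move=> V nV; rewrite wedge_baseE (negPf nV) andbF mul0r.
rewrite (bigD1 (I :|: J)) //= [X in _ = _ + X]big1 ?addr0; last first.
  by move=> V nV; rewrite wedge_baseE (negPf nV) andbF mul0r.
rewrite !wedge_baseE !eqxx !andbT setUA disjU.
rewrite (disjoint_sym (I :|: J)) disjU ![[disjoint U & _]]disjoint_sym.
case dJU: [disjoint J & U]; case dIJ: [disjoint I & J];
  case dIU: [disjoint I & U]; rewrite ?mul0r ?mulr0 //=.
case: eqP => _; rewrite ?mulr0 // -!exprD inversionsUl // inversionsUr //.
by congr (_ ^+ _); rewrite addnC addnA.
Qed.

Lemma wedgeA : associative wedge.
Proof.
move=> a b c; apply/ffunP => S; rewrite !wedgeE.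
transitivity (\sum_I \sum_J \sum_U a I * b J * c U *
  \sum_V wedge_base J U V * wedge_base I V S).
  apply: eq_bigr => I _.
  transitivity (\sum_V \sum_J \sum_U
     a I * b J * c U * (wedge_base J U V * wedge_base I V S)).
    apply: eq_bigr => V _; rewrite wedgeE mulr_sumr mulr_suml.
    apply: eq_bigr => J _; rewrite mulr_sumr mulr_suml.
    by apply: eq_bigr => U _; rewrite !mulrA.
  rewrite exchange_big /=; apply: eq_bigr => J _.
  by rewrite exchange_big /=; apply: eq_bigr => U _; rewrite mulr_sumr.
transitivity (\sum_V \sum_U \sum_I \sum_J
     a I * b J * c U * (wedge_base I J V * wedge_base V U S)); last first.
  apply: eq_bigr => V _; apply: eq_bigr => U _.
  rewrite wedgeE !mulr_suml; apply: eq_bigr => I _.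
  by rewrite !mulr_suml; apply: eq_bigr => J _; rewrite -!mulrA;
     do 2 congr (_ * _); rewrite mulrCA.
rewrite [RHS]exchange_big /=.
transitivity (\sum_U \sum_I \sum_J \sum_V
     a I * b J * c U * (wedge_base I J V * wedge_base V U S)); last first.
  apply: eq_bigr => U _; rewrite [RHS]exchange_big /=.
  by apply: eq_bigr => I _; rewrite [RHS]exchange_big.
rewrite [RHS]exchange_big /=; apply: eq_bigr => I _.
rewrite [RHS]exchange_big /=; apply: eq_bigr => J _; apply: eq_bigr => U _.
by rewrite wedge_baseA mulr_sumr.
Qed.

Lemma wedgeDl : left_distributive wedge +%R.
Proof.
move=> a b c; rewrite /wedge -big_split /=; apply: eq_bigr => I _.
by rewrite -big_split /=; apply: eq_bigr => J _; rewrite extD mulrDl scalerDl.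
Qed.

Lemma wedgeDr : right_distributive wedge +%R.
Proof.
move=> a b c; rewrite /wedge -big_split /=; apply: eq_bigr => I _.
by rewrite -big_split /=; apply: eq_bigr => J _; rewrite extD mulrDr scalerDl.
Qed.

Lemma wedgeZl (k : K) a b : k *: wedge a b = wedge (k *: a) b.
Proof.
rewrite /wedge scaler_sumr; apply: eq_bigr => I _.
rewrite scaler_sumr; apply: eq_bigr => J _.
by rewrite extZ scalerA mulrA.
Qed.

Lemma wedgeZr (k : K) a b : k *: wedge a b = wedge a (k *: b).
Proof.
rewrite /wedge scaler_sumr; apply: eq_bigr => I _.
rewrite scaler_sumr; apply: eq_bigr => J _.
by rewrite extZ scalerA mulrCA.
Qed.

Lemma wedge1l : left_id (ebase set0) wedge.
Proof.
move=> a; rewrite /wedge (bigD1 set0) //= [X in _ + X]big1 ?addr0; last first.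
  move=> I nI; apply: big1 => J _.
  by rewrite ffunE (negPf nI) mul0r scale0r.
rewrite [RHS]extE; apply: eq_bigr => J _; rewrite ffunE eqxx mul1r.
by rewrite /wedge_base -setI_eq0 set0I eqxx set0U /inversions big_set0 scale1r.
Qed.

Lemma wedge1r : right_id (ebase set0) wedge.
Proof.
move=> a; rewrite /wedge exchange_big (bigD1 set0) //=.
rewrite [X in _ + X]big1 ?addr0; last first.
  move=> I nI; apply: big1 => J _.
  by rewrite ffunE (negPf nI) mulr0 scale0r.
rewrite [RHS]extE; apply: eq_bigr => J _; rewrite ffunE eqxx mulr1.
rewrite /wedge_base -setI_eq0 setI0 eqxx setU0 /inversions.
by rewrite big1 ?scale1r // => i _; rewrite big_set0.
Qed.

Lemma ebase0_neq0 : ebase set0 != 0.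
Proof.
by apply/eqP => /ffunP /(_ set0); rewrite !ffunE eqxx; apply/eqP/oner_neq0.
Qed.

HB.instance Definition _ := GRing.Zmodule_isNzRing.Build (ext K m)
  wedgeA wedge1l wedge1r wedgeDl wedgeDr ebase0_neq0.
HB.instance Definition _ := GRing.Lmodule_isLalgebra.Build K (ext K m) wedgeZl.
HB.instance Definition _ := GRing.Lalgebra_isAlgebra.Build K (ext K m) wedgeZr.

Lemma ebaseM I J : ebase I * ebase J = wedge_base I J.
Proof.
rewrite [LHS]/(wedge _ _) /wedge (bigD1 I) //= [X in _ + X]big1 ?addr0; last first.
  move=> I' nI; apply: big1 => J' _.
  by rewrite ffunE (negPf nI) mul0r scale0r.
rewrite (bigD1 J) //= [X in _ + X]big1 ?addr0; last first.
  by move=> J' nJ; rewrite [X in _ * X]ffunE (negPf nJ) mulr0 scale0r.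
by rewrite !ffunE !eqxx mulr1 scale1r.
Qed.

Definition evec (i : 'I_m) : ext K m := ebase [set i].

Lemma evec_anticomm i j : evec i * evec j = - (evec j * evec i).
Proof.
rewrite /evec !ebaseM /wedge_base !disjoints1 !inE eq_sym.
case: (eqVneq i j) => [_|nij] /=; first by rewrite oppr0.
rewrite /inversions !big_set1 setUC -scaleNr; congr (_ *: _).
by case: ltngtP nij => [||/val_inj->] //=; rewrite ?eqxx ?opprK ?expr0 ?expr1.
Qed.

(* The algebra endomorphism induced by e^i |-> \sum_j g_{ji} e^j; products over
   ordinals are taken in increasing order of the index. *)
Definition extmap (g : 'M[K]_m) a : ext K m :=
  \sum_I a I *: \prod_(i in I) (\sum_j g j i *: evec j).

Definition homogeneous (p : nat) a : Prop :=
  forall S : {set 'I_m}, #|S| != p -> a S = 0.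

Lemma extmap_is_linear (g : 'M[K]_m) : linear (extmap g).
Proof.
move=> k a b; rewrite /extmap scaler_sumr -big_split /=.
by apply: eq_bigr => I _; rewrite extD extZ scalerDl scalerA.
Qed.

HB.instance Definition _ (g : 'M[K]_m) :=
  GRing.isLinear.Build K (ext K m) (ext K m) _ (extmap g) (extmap_is_linear g).

Lemma extmap_ebase (g : 'M[K]_m) I :
  extmap g (ebase I) = \prod_(i in I) (\sum_j g j i *: evec j).
Proof.
rewrite /extmap (bigD1 I) //= [X in _ + X]big1 ?addr0; last first.
  by move=> J nJ; rewrite ffunE (negPf nJ) scale0r.
by rewrite ffunE eqxx scale1r.
Qed.

Lemma extmap1 (g : 'M[K]_m) : extmap g 1 = 1.
Proof. by rewrite [in LHS]/1 /= extmap_ebase big_set0. Qed.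
End Wedge.

Section UniversalProperty.
Variables (K : comNzRingType) (m : nat) (B : algType K) (v : 'I_m -> B).
Hypothesis vv0 : forall i, v i * v i = 0.
Hypothesis vC : forall i j, v i * v j = - (v j * v i).
Implicit Types (I J : {set 'I_m}).

Lemma mul_prod_seq (i : 'I_m) J (s : seq 'I_m) :
  i \in s -> sorted (fun j k : 'I_m => j < k)%N s ->
  v i * \prod_(j <- s | j \in J) v j =
  if i \in J then 0 else
  (-1) ^+ (\sum_(j <- s | j \in J) (j < i))%N *
     \prod_(j <- s | j \in i |: J) v j.
Proof.
elim: s => // x s IHs; rewrite inE => xs /= pxs.
have ss := path_sorted pxs.
have lt_s : forall j, j \in s -> (x < j)%N.
  have tr : transitive (fun j k : 'I_m => j < k)%N by move=> ? ? ?; apply: ltn_trans.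
  by move=> j js; have /allP := order_path_min tr pxs; apply.
rewrite !big_cons; case: (eqVneq i x) xs => [ix _|nix /= xs].
  rewrite -{x IHs pxs}ix in lt_s *; rewrite setU11; case: ifP => iJ; first by rewrite mulrA vv0 mul0r.
  rewrite (_ : (\sum_(j <- s | _) _)%N = 0%N) ?mul1r; last first.
    rewrite big_seq_cond big1 // => j /andP[js _].
    by rewrite ltnNge ltnW ?lt_s.
  congr (_ * _); rewrite big_seq_cond [RHS]big_seq_cond; apply: eq_bigl => j.
  case js: (j \in s) => //=; rewrite !inE.
  by case: eqP (lt_s j js) => // ->; rewrite ltnn.
have xi : (x < i)%N by apply: lt_s.
rewrite !inE eq_sym (negPf nix) /=.
case xJ: (x \in J); last by rewrite IHs.
rewrite mulrA vC mulNr -mulrA IHs //; case: ifP => iJ; first by rewrite mulr0 oppr0.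
rewrite xi exprD expr1 mulN1r mulNr; congr (- _).
by rewrite !mulrA; congr (_ * _); exact: commr_sign.
Qed.

Lemma mul_prod1 (i : 'I_m) J :
  v i * \prod_(j in J) v j =
  if i \in J then 0 else
  (-1) ^+ (\sum_(j in J) (j < i))%N * \prod_(j in i |: J) v j.
Proof.
apply: mul_prod_seq; first exact: mem_index_enum.
rewrite /index_enum unlock /= -[Finite.enum _]enumT.
have := iota_ltn_sorted 0 m; rewrite -val_enum_ord sorted_map.
by apply.
Qed.

Lemma mul_prod I J :
  \prod_(i in I) v i * \prod_(j in J) v j =
  if [disjoint I & J]
  then (-1) ^+ inversions I J * \prod_(i in I :|: J) v i else 0.
Proof.
have [p] := ubnP #|I|; elim: p => // p IHp in I *; rewrite ltnS => Ip.
have [->|[i0 i0I]] := set_0Vmem I.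
  by rewrite big_set0 -setI_eq0 set0I eqxx set0U /inversions big_set0 !mul1r.
have [i iI min_i] := arg_minnP (P := mem I) val i0I.
have iN : i \notin I :\ i by rewrite !inE eqxx.
have PI : \prod_(j in I) v j = v i * \prod_(j in I :\ i) v j.
  rewrite mul_prod1 (negPf iN) setD1K // [X in _ ^+ X]big1 ?mul1r // => j.
  by rewrite !inE => /andP[_ /min_i]; rewrite leqNgt => /negPf->.
have {}iI : i \in I := iI.
rewrite PI -mulrA IHp; last by move: Ip; rewrite (cardsD1 i) iI.
have dE : [disjoint I & J] = (i \notin J) && [disjoint I :\ i & J].
  by rewrite -{1}(setD1K iI) -!setI_eq0 setIUl setU_eq0 setI_eq0 disjoints1.
rewrite dE; case: ifP => dIJ; last by rewrite mulr0 andbF.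
rewrite mulrA commr_sign -mulrA mul_prod1 !inE eqxx /= andbT.
case: (boolP (i \in J)) => iJ /=; first by rewrite mulr0.
rewrite setUA setD1K // mulrA -exprD; congr (_ ^+ _ * _).
rewrite /inversions [RHS](big_setD1 i) //= addnC; congr (_ + _)%N.
rewrite (eq_bigl [in [predU I :\ i & J]]); last by move=> j; rewrite !inE.
rewrite bigU //= big1 // => j; rewrite !inE => /andP[_ /min_i].
by rewrite leqNgt => /negPf->.
Qed.

End UniversalProperty.

Section RealForms.
Variables (R : realFieldType) (m : nat).
Implicit Types (g : 'M[R]_m) (a b : ext R m).

Lemma extmapM g a b : extmap g (a * b) = extmap g a * extmap g b.
Proof.
pose v i : ext R m := \sum_j g j i *: evec R j.
have vC i j : v i * v j = - (v j * v i).
  rewrite /v !mulr_suml -sumrN.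
  under eq_bigr do rewrite mulr_sumr.
  under [RHS]eq_bigr do rewrite mulr_sumr -sumrN.
  rewrite exchange_big; apply: eq_bigr => k _; apply: eq_bigr => l _ /=.
  by rewrite -!scalerAl -!scalerAr evec_anticomm !scalerN scalerA mulrC -scalerA.
have vv0 i : v i * v i = 0.
  apply/eqP; have /eqP := vC i i; rewrite -addr_eq0 -mulr2n -scaler_nat.
  by rewrite scaler_eq0 pnatr_eq0.
rewrite [a * b]/(wedge a b) /wedge linear_sum /= {2 3}/extmap mulr_suml.
apply: eq_bigr => I _; rewrite linear_sum mulr_sumr; apply: eq_bigr => J _ /=.
rewrite linearZ /= -scalerAl -scalerAr scalerA; congr (_ *: _).
rewrite (mul_prod vv0 vC) /wedge_base; case: ifP => _; last by rewrite linear0.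
rewrite linearZ /= extmap_ebase -(signr_odd R) -(signr_odd (ext R m)).
by rewrite scaler_sign mulr_sign.
Qed.
End RealForms.

Section ComplexForms.
Variables (R : rcfType) (m : nat).
Implicit Types (a b : ext R m) (z : ext R[i] m).
Local Notation toC := (real_complex R).

Definition Re_form z : ext R m := [ffun S => complex.Re (z S)].
Definition Im_form z : ext R m := [ffun S => complex.Im (z S)].

Definition ext_complex a : ext R[i] m := [ffun S => toC (a S)].

Lemma ext_complexE a S : ext_complex a S = toC (a S).
Proof. by rewrite ffunE. Qed.

Lemma ext_complex_ebase S : ext_complex (ebase R S) = ebase R[i] S.
Proof. by apply/ffunP => U; rewrite ext_complexE !ffunE rmorph_nat. Qed.

Lemma ext_complexD : {morph ext_complex : a b / a + b}.
Proof. by move=> a b; apply/ffunP => S; rewrite extD !ext_complexE extD rmorphD. Qed.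

Lemma ext_complex0 : ext_complex 0 = 0.
Proof. by apply/ffunP => S; rewrite ext_complexE !ffunE rmorph0. Qed.

Lemma ext_complexZ (k : R) a : ext_complex (k *: a) = toC k *: ext_complex a.
Proof. by apply/ffunP => S; rewrite extZ !ext_complexE extZ rmorphM. Qed.

Lemma ext_complexM : {morph ext_complex : a b / a * b}.
Proof.
move=> a b; apply/ffunP => S; rewrite ext_complexE.
rewrite [a * b]/(wedge a b) [_ * ext_complex b]/(wedge _ _) !wedgeE rmorph_sum.
apply: eq_bigr => I _; rewrite rmorph_sum; apply: eq_bigr => J _ /=.
rewrite !rmorphM !ext_complexE !wedge_baseE; congr (_ * _).
by case: ifP => _; rewrite ?rmorph0 // rmorphXn rmorphN1.
Qed.

Lemma ext_complex1 : ext_complex 1 = 1.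
Proof. exact: ext_complex_ebase. Qed.

Lemma extmap_complexE (g : 'M[R]_m) z S :
  extmap (map_mx toC g) z S = \sum_I z I * toC (extmap g (ebase R I) S).
Proof.
rewrite ext_sum; apply: eq_bigr => I _; rewrite extZ; congr (_ * _).
rewrite extmap_ebase -ext_complexE.
rewrite (big_morph _ ext_complexM ext_complex1); congr (fun_of_fin _ S).
apply: eq_bigr => i _; rewrite (big_morph _ ext_complexD ext_complex0).
by apply: eq_bigr => j _; rewrite mxE ext_complexZ ext_complex_ebase.
Qed.

Lemma extmap_coefE (g : 'M[R]_m) a S :
  extmap g a S = \sum_I a I * extmap g (ebase R I) S.
Proof.
by rewrite ext_sum; apply: eq_bigr => I _; rewrite extZ extmap_ebase.
Qed.

Lemma Re_extmap (g : 'M[R]_m) z :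
  Re_form (extmap (map_mx toC g) z) = extmap g (Re_form z).
Proof.
apply/ffunP => S; rewrite ffunE extmap_complexE extmap_coefE.
rewrite (big_morph (@complex.Re R) (id1 := 0) (op1 := +%R)) //; last by case=> ? ? [].
apply: eq_bigr => I _; rewrite ffunE; case: (z I) => x y /=.
by rewrite mulr0 subr0.
Qed.

Lemma Im_extmap (g : 'M[R]_m) z :
  Im_form (extmap (map_mx toC g) z) = extmap g (Im_form z).
Proof.
apply/ffunP => S; rewrite ffunE extmap_complexE extmap_coefE.
rewrite (big_morph (@complex.Im R) (id1 := 0) (op1 := +%R)) //; last by case=> ? ? [].
apply: eq_bigr => I _; rewrite ffunE; case: (z I) => x y /=.
by rewrite mulr0 add0r.
Qed.
End ComplexForms.

Section SU.
Variables (R : realType) (n : nat).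

Fact idx_odd_subproof (k : 'I_n) : (2 * k < 2 * n)%N.
Proof. by rewrite ltn_pmul2l. Qed.

Fact idx_even_subproof (k : 'I_n) : ((2 * k).+1 < 2 * n)%N.
Proof. by rewrite -[(2 * k).+2]/(2 + 2 * k)%N -mulnS leq_pmul2l. Qed.

(* Ordinals count from 0: with the k-th pair (k < n), [idx_odd k] and
   [idx_even k] are the positions of e^{2k+1} and e^{2k+2}. *)
Definition idx_odd (k : 'I_n) : 'I_(2 * n) := Ordinal (idx_odd_subproof k).
Definition idx_even (k : 'I_n) : 'I_(2 * n) := Ordinal (idx_even_subproof k).

Definition F_form : ext R (2 * n) :=
  \sum_(k < n) evec R (idx_odd k) * evec R (idx_even k).

Definition Omega_form : ext R[i] (2 * n) :=
  \prod_(k < n) (evec R[i] (idx_odd k) + 'i%C *: evec R[i] (idx_even k)).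

Definition Omegap_form : ext R (2 * n) := Re_form Omega_form.
Definition Omegam_form : ext R (2 * n) := Im_form Omega_form.

Definition special_unitary (g : 'M[R]_(2 * n)) : Prop :=
  [/\ g^T *m g = 1%:M, extmap g F_form = F_form &
      extmap (map_mx (real_complex R) g) Omega_form = Omega_form].

Definition SU_invariant : {pred ext R (2 * n)} :=
  fun a => `[< forall g, special_unitary g -> extmap g a = a >].

Lemma SU_invariantP a :
  reflect (forall g, special_unitary g -> extmap g a = a) (a \in SU_invariant).
Proof. exact: asboolP. Qed.

Fact SU_invariant_subalg : subalg_closed SU_invariant.
Proof.
split=> [|k a b /SU_invariantP ha /SU_invariantP hb
         |a b /SU_invariantP ha /SU_invariantP hb];
  apply/SU_invariantP => g hg.
- exact: extmap1.
- by rewrite linearP /= ha ?hb.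
- by rewrite extmapM ha ?hb.
Qed.

HB.instance Definition _ :=
  GRing.isSubalgClosed.Build R (ext R (2 * n)) SU_invariant SU_invariant_subalg.

Record SUform := MkSUform {
  SUform_val :> ext R (2 * n);
  SUform_invariant : SUform_val \in SU_invariant
}.

HB.instance Definition _ := [isSub for SUform_val].
HB.instance Definition _ := [Choice of SUform by <:].
HB.instance Definition _ := [SubChoice_isSubAlgebra of SUform by <:].

Fact F_invariant : F_form \in SU_invariant.
Proof. by apply/SU_invariantP => g []. Qed.

Fact Omegap_invariant : Omegap_form \in SU_invariant.
Proof. by apply/SU_invariantP => g [_ _ gO]; rewrite -Re_extmap gO. Qed.

Fact Omegam_invariant : Omegam_form \in SU_invariant.
Proof. by apply/SU_invariantP => g [_ _ gO]; rewrite -Im_extmap gO. Qed.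

Definition SU_F : SUform := MkSUform F_invariant.
Definition SU_Omegap : SUform := MkSUform Omegap_invariant.
Definition SU_Omegam : SUform := MkSUform Omegam_invariant.

Definition SUhomogeneous (p : nat) (a : SUform) : Prop :=
  homogeneous p (SUform_val a).
End SU.

Section Derivations.
Variables (K : comNzRingType) (A : lalgType K) (homog : nat -> A -> Prop).

(* [homog p a] means that a lies in the degree-p component of A. *)
Definition derivation_degree1 (f : {linear A -> A}) : Prop :=
  (forall p a, homog p a -> homog p.+1 (f a)) /\
  (forall p a b, homog p a -> f (a * b) = f a * b + (-1) ^+ p * (a * f b)).

Definition differential_operator (f : {linear A -> A}) : Prop :=
  derivation_degree1 f /\ (forall a, f (f a) = 0).
End Derivations.

(* Main.v *)
Require Import Defs.
From mathcomp Require Import all_boot all_order all_algebra.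
From mathcomp Require Import boolp reals.
From mathcomp.real_closed Require Import complex.
From mathcomp Require Import ring lra.
Import Order.TTheory GRing.Theory Num.Theory.
Local Open Scope ring_scope.

Set Implicit Arguments.
Unset Strict Implicit.
Unset Printing Implicit Defensive.

(** Write z_k = e^{2k-1} + i e^{2k} for the k-th complex coordinate ([dz] below,
    where k counts from 0). Changing the sign of two of the z_k is an element of
    SU(n). It multiplies a basis form e^I by a sign that only depends on the
    parities of the numbers of indices of I in the n coordinate pairs; hence the
    basis forms occurring in an invariant form have the same parity in all pairs
    ([invariant_parity]).

    A derivation D of degree one maps e^i to a combination of e^S with |S| = 2.
    Between {i} and S exactly three indices are distributed over the n pairs, so
    the parity vectors of {i} and S differ by an odd number, at most three, of
    entries. They can differ by a constant vector only if n = 3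
    ([parity_equiv_12]), and by the Leibniz rule the same is true of every e^I and
    the basis forms in D(e^I) ([derivation_parity_shift]). So if n <> 3 and a is
    invariant, the basis forms in D(a) are not among those allowed in an invariant
    form; as f(a) = D(a) is invariant, it is zero. This settles the values of f on
    all invariant forms without knowing generators of their algebra.

    For n = 3 it is f itself that is computed. Two more kinds of elements of SU(3),
    the diagonal matrices of determinant 1 with entries in {1, -1, i, -i} and the
    cyclic permutation of the coordinates, permute the basis forms up to sign. This
    is enough to see that the invariants of degree 3 are spanned by Omega^+ and
    Omega^- ([invariant_degree3]) and those of degree 4 by F^2
    ([invariant_degree4]). Hence
    f(F) = lambda Omega^+ + mu Omega^-, f(Omega^+) = p F^2 and f(Omega^-) = q F^2.
    Applying f to F Omega^+ = F Omega^- = 0 yields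
    f(F) Omega^+ + p F^3 = 0 and f(F) Omega^- + q F^3 = 0, and the relations
    Omega^+ Omega^- = 4 vol, Omega^+ Omega^+ = Omega^- Omega^- = 0, F^3 = 6 vol
    turn these into 6 p = 4 mu and 6 q = - 4 lambda. *)

(** * Degrees and linear forms in the exterior algebra *)

Section Exterior.
Variables (K : comNzRingType) (m : nat).
Implicit Types (a b v w : ext K m) (I J S : {set 'I_m}).

Lemma wedge_coef_eq0 a b S :
    (forall I J, [disjoint I & J] -> S = I :|: J -> a I * b J = 0) ->
  (a * b) S = 0.
Proof.
move=> ab0; rewrite [a * b]/(wedge a b) wedgeE big1 // => I _.
rewrite big1 // => J _; rewrite wedge_baseE.
by case: ifP => [/andP[dIJ /eqP SE]|_]; rewrite ?mulr0 // ab0 ?mul0r.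
Qed.

Lemma homogeneousM p q a b :
  homogeneous p a -> homogeneous q b -> homogeneous (p + q) (a * b).
Proof.
move=> ha hb S nS; apply: wedge_coef_eq0 => I J dIJ SE.
have [Ip|nI] := eqVneq #|I| p; last by rewrite ha ?mul0r.
rewrite hb ?mulr0 //; apply: contraNneq nS => Jq.
by rewrite SE cardsU disjoint_setI0 // cards0 subn0 Ip Jq.
Qed.

Lemma homogeneousD p a b :
  homogeneous p a -> homogeneous p b -> homogeneous p (a + b).
Proof. by move=> ha hb S nS; rewrite extD ha ?hb ?addr0. Qed.

Lemma homogeneousZ p (k : K) a : homogeneous p a -> homogeneous p (k *: a).
Proof. by move=> ha S nS; rewrite extZ ha ?mulr0. Qed.

Lemma homogeneous0 p : homogeneous p (0 : ext K m).
Proof. by move=> S _; rewrite ffunE. Qed.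

Lemma homogeneous_sum p (T : Type) (r : seq T) (F : T -> ext K m) :
  (forall t, homogeneous p (F t)) -> homogeneous p (\sum_(t <- r) F t).
Proof.
move=> hF; apply: big_ind => //; [exact: homogeneous0|exact: homogeneousD].
Qed.

Lemma homogeneous_ebase S : homogeneous #|S| (ebase K S).
Proof. by move=> U nU; rewrite ffunE; case: (U =P S) nU => [->|]; rewrite ?eqxx. Qed.

Lemma homogeneous_one : homogeneous 0 (1 : ext K m).
Proof. by have := @homogeneous_ebase set0; rewrite cards0. Qed.

Lemma homogeneous_evec i : homogeneous 1 (evec K i : ext K m).
Proof. by rewrite -(cards1 i); apply: homogeneous_ebase. Qed.

Lemma homogeneous_prod (T : Type) (r : seq T) (F : T -> ext K m) :
  (forall t, homogeneous 1 (F t)) -> homogeneous (size r) (\prod_(t <- r) F t).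
Proof.
move=> hF; elim: r => [|t r IHr]; last first.
  by rewrite big_cons /= -add1n; apply: homogeneousM.
by rewrite big_nil; exact: homogeneous_one.
Qed.

Lemma ext_in_degree0 p a :
  homogeneous p a -> (forall S, #|S| = p -> a S = 0) -> a = 0.
Proof.
move=> ha a0; apply/ffunP => S; rewrite [RHS]ffunE.
by have [/a0|/ha] := eqVneq #|S| p.
Qed.

Lemma evec_sq0 i : evec K i * evec K i = 0 :> ext K m.
Proof.
by rewrite /evec ebaseM /wedge_base -setI_eq0 setIid -cards_eq0 cards1.
Qed.

Lemma linear_formE v : homogeneous 1 v -> v = \sum_i v [set i] *: evec K i.
Proof.
move=> hv; apply/ffunP => S; rewrite ext_sum.
under eq_bigr do rewrite extZ ffunE.
have [/eqP/cards1P[i ->]|nS] := eqVneq #|S| 1%N.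
  rewrite (bigD1 i) //= eqxx mulr1 big1 ?addr0 // => j ji.
  by rewrite (inj_eq set1_inj) eq_sym (negPf ji) mulr0.
rewrite hv // big1 // => i _; case: (S =P _) nS => [->|]; rewrite ?mulr0 //.
by rewrite cards1.
Qed.

(** Squares vanish over any base ring, by adding one basis vector at a time; expanding
    the square of a sum then gives anticommutation without a division by 2. *)
Lemma linear_form_sq0 v : homogeneous 1 v -> v * v = 0.
Proof.
move/linear_formE->; set w : ext K m := \sum_i _.
suff: w * w = 0 /\ forall j, w * evec K j = - (evec K j * w) by case.
pose P (u : ext K m) := u * u = 0 /\ forall j, u * evec K j = - (evec K j * u).
rewrite -/(P w) {}/w; apply: big_rec => [|i w _ [w0 wC]].
  by split=> [|j]; rewrite mul0r ?mulr0 ?oppr0.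
split=> [|j].
  rewrite mulrDl !mulrDr w0 addr0 -!scalerAl -!scalerAr evec_sq0 !scaler0 add0r.
  by rewrite wC scalerN subrr.
by rewrite mulrDl mulrDr -!scalerAl -!scalerAr evec_anticomm wC scalerN opprD.
Qed.

Lemma linear_form_anticomm v w :
  homogeneous 1 v -> homogeneous 1 w -> v * w = - (w * v).
Proof.
move=> hv hw; apply/eqP; rewrite -addr_eq0.
have := linear_form_sq0 (homogeneousD hv hw).
by rewrite mulrDl !mulrDr !linear_form_sq0 // addr0 add0r => ->.
Qed.

Lemma evec_ebase i J : i \notin J ->
  exists e : bool, evec K i * ebase K J = (-1) ^+ e *: ebase K (i |: J).
Proof.
move=> iJ; exists (odd (inversions [set i] J)).
by rewrite /evec ebaseM /wedge_base disjoints1 iJ signr_odd.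
Qed.

(** The sign is left unspecified here and in several statements below: either it
    cancels, or only the vanishing of a coefficient is at stake. *)
Lemma prod_evec (r : seq 'I_m) : uniq r ->
  exists e : bool,
    \prod_(i <- r) evec K i = (-1) ^+ e *: ebase K [set i in r].
Proof.
elim: r => [_|i r IHr /= /andP[ir /IHr[e re]]].
  by exists false; rewrite big_nil scale1r (_ : [set i in [::]] = set0).
have [|e' ie'] := @evec_ebase i [set j in r]; first by rewrite inE.
exists (e (+) e'); rewrite big_cons re -scalerAr ie' scalerA signr_addb.
by congr (_ *: ebase K _); apply/setP => j; rewrite !inE.
Qed.

Lemma ebase_prod S :
  exists e : bool, ebase K S = (-1) ^+ e *: \prod_(i <- enum S) evec K i.
Proof.
have [e ->] := prod_evec (enum_uniq S).
exists e; rewrite scalerA -signr_addb addbb scale1r; congr (ebase K _).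
by apply/setP => i; rewrite inE mem_enum.
Qed.

End Exterior.

(** * Coordinate pairs, parities, and the parity shift of a derivation *)

Section Pairs.
Variable n : nat.
Implicit Types (k l : 'I_n) (i : 'I_(2 * n)) (S T U : {set 'I_(2 * n)}).

Fact pair_of_subproof i : (i./2 < n)%N.
Proof. by rewrite ltn_half_double -mul2n. Qed.

Definition pair_of i : 'I_n := Ordinal (pair_of_subproof i).

Definition idx k (b : bool) : 'I_(2 * n) := if b then idx_even k else idx_odd k.

Lemma val_idx k b : idx k b = (b + k.*2)%N :> nat.
Proof. by case: b => /=; rewrite mul2n. Qed.

Lemma pair_of_idx k b : pair_of (idx k b) = k.
Proof. by apply: val_inj; rewrite /= val_idx half_bit_double. Qed.

Lemma odd_idx k b : odd (idx k b) = b.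
Proof. by rewrite val_idx oddD odd_double addbF; case: b. Qed.

Lemma idx_pair_of i : idx (pair_of i) (odd i) = i.
Proof. by apply: val_inj; rewrite /= val_idx odd_double_half. Qed.

Lemma idx_inj k l b c : idx k b = idx l c -> k = l /\ b = c.
Proof.
move=> e; split; first by rewrite -(pair_of_idx k b) e pair_of_idx.
by rewrite -(odd_idx k b) e odd_idx.
Qed.

Lemma big_idx (U : Type) (x0 : U) (op : Monoid.com_law x0) (F : 'I_(2 * n) -> U) :
  \big[op/x0]_i F i = \big[op/x0]_(k < n) op (F (idx k false)) (F (idx k true)).
Proof.
rewrite (reindex (fun p : 'I_n * bool => idx p.1 p.2)) /=; last first.
  exists (fun i => (pair_of i, odd i)) => [[k b] _|i _] /=.
    by rewrite pair_of_idx odd_idx.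
  exact: idx_pair_of.
rewrite -(pair_big xpredT xpredT (fun k b => F (idx k b))) /=.
by apply: eq_bigr => k _; rewrite big_bool Monoid.mulmC.
Qed.

(** The number of elements of S in the k-th pair, written so that case analysis on
    the two memberships computes it. *)
Definition occupancy S k : nat := (idx k false \in S) + (idx k true \in S).

Lemma occupancy_le2 S k : (occupancy S k <= 2)%N.
Proof. by rewrite /occupancy; do 2!case: (_ \in _). Qed.

Lemma occupancyU S T k : [disjoint S & T] ->
  occupancy (S :|: T) k = (occupancy S k + occupancy T k)%N.
Proof.
move=> /disjoint_setI0/setP dST; rewrite /occupancy !inE.
have := dST (idx k false); have := dST (idx k true); rewrite !inE.
by do 4!case: (_ \in _).
Qed.

Lemma sum_occupancy S : (\sum_k occupancy S k)%N = #|S|.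
Proof.
rewrite -sum1_card [RHS]big_mkcond [RHS]big_idx; apply: eq_bigr => k _.
by rewrite /occupancy; do 2!case: (_ \in _).
Qed.

Lemma prod_pair_of (K : comPzRingType) (t : 'I_n -> K) S :
  \prod_(i in S) t (pair_of i) = \prod_k t k ^+ occupancy S k.
Proof.
rewrite [LHS]big_mkcond [LHS]big_idx; apply: eq_bigr => k _; rewrite !pair_of_idx.
by rewrite /occupancy; do 2!case: (_ \in _) => /=; rewrite ?mulr1 ?mul1r.
Qed.

(** S and T have parity vectors that agree up to adding the same bit to all entries:
    the corresponding basis forms transform alike under all even sign changes. *)
Definition parity_equiv S T : Prop :=
  forall k l, odd (occupancy S k + occupancy T k) =
              odd (occupancy S l + occupancy T l).

Lemma parity_equiv_cancel S T U : [disjoint S & T] -> [disjoint S & U] ->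
  parity_equiv (S :|: T) (S :|: U) -> parity_equiv T U.
Proof.
move=> dST dSU eqTU k l; have := eqTU k l; rewrite !occupancyU //.
rewrite (addnACA (occupancy S k)) (addnACA (occupancy S l)) !addnn.
by rewrite ![odd (_.*2 + _)]oddD !odd_double.
Qed.

(** The three indices in {i} and S contribute to the n pairs numbers that all have
    the same parity. These cannot all be even, since their sum is 3; so they are
    all odd, hence positive, and n is an odd number between 2 and 3. *)
Lemma parity_equiv_12 i S :
  (2 <= n)%N -> #|S| = 2%N -> parity_equiv [set i] S -> n = 3%N.
Proof.
move=> n2 S2 eqiS; pose o k := (occupancy [set i] k + occupancy S k)%N.
have sum3 : (\sum_k o k)%N = 3%N by rewrite big_split /= !sum_occupancy cards1 S2.
pose k0 : 'I_n := Ordinal (ltnW n2).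
have oddo k : odd (o k) = odd (o k0) by exact: eqiS.
have odd3 : odd n && odd (o k0).
  have : odd (\sum_k o k)%N by rewrite sum3.
  rewrite (big_morph odd oddD (erefl : odd 0 = false)) (eq_bigr _ (fun k _ => oddo k)).
  rewrite big_const card_ord.
  suff -> p : iter p (addb (odd (o k0))) false = odd p && odd (o k0) by [].
  elim: p => //= p ->.
  by case: (odd (o k0)); rewrite ?andbF ?andbT.
have : (n <= 3)%N.
  rewrite -sum3 -[leqLHS]card_ord -sum1_card; apply: leq_sum => k _.
  by have := oddo k; case/andP: odd3 => _ ->; case: (o k).
by case/andP: odd3 => + _; move: (n2); case: (n) => [|[|[|[|]]]].
Qed.

Section Derivation.
Variables (K : comNzRingType).
Variable D : {linear ext K (2 * n) -> ext K (2 * n)}.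
Hypothesis derD : derivation_degree1 (@homogeneous K (2 * n)) D.

(** Induction on |I|: in D(e^i e^J) = D(e^i) e^J - e^i D(e^J) the common factor can be
    cancelled from the parities, which leaves the case of a single e^i for the
    first term and the induction hypothesis for the second. *)
Lemma derivation_parity_shift I S : (2 <= n)%N -> n <> 3%N ->
  parity_equiv I S -> D (ebase K I) S = 0.
Proof.
case: derD => degD leibD n2 n3.
have [p] := ubnP #|I|; elim: p => // p IHp in I S *; rewrite ltnS => Ip eqIS.
have [->|[i iI]] := set_0Vmem I.
  have /eqP := leibD 0 1 1 (@homogeneous_one K _).
  rewrite !mulr1 expr0 !mul1r eq_sym -subr_eq0 addrK => /eqP D1.
  by rewrite [ebase K set0]/(1 : ext K _) D1 ffunE.
have [J0 iJ0 IE] : exists2 J : {set 'I_(2 * n)}, i \notin J & I = i |: J.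
  by exists (I :\ i); rewrite ?setD1K // !inE eqxx.
rewrite {I}IE cardsU1 iJ0 add1n in iI Ip eqIS *.
have [e eI] := evec_ebase K iJ0.
suff : D (evec K i * ebase K J0) S = 0.
  by rewrite eI linearZ extZ /= => /(congr1 ( *%R ((-1) ^+ e))); rewrite mulr0 signrMK.
have di0 : [disjoint [set i] & J0] by rewrite disjoints1.
rewrite (leibD 1%N) ?extD; last exact: homogeneous_evec.
rewrite wedge_coef_eq0 ?add0r => [|U J dUJ SE].
  rewrite expr1 mulN1r ffunE wedge_coef_eq0 ?oppr0 // => U J dUJ SE.
  have [Ui|nU] := eqVneq U [set i]; last by rewrite ffunE (negPf nU) mul0r.
  rewrite IHp ?mulr0 //; apply: (@parity_equiv_cancel [set i]) => //.
    by rewrite -Ui.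
  by rewrite -[in X in parity_equiv _ X]Ui -SE.
have [JE|nJ] := eqVneq J J0; last by rewrite [X in _ * X]ffunE (negPf nJ) mulr0.
have [U2|nU] := eqVneq #|U| 2%N; last first.
  by rewrite (degD 1%N) ?mul0r //; exact: homogeneous_evec.
case: n3; apply: (parity_equiv_12 n2 U2 (i := i)).
apply: (@parity_equiv_cancel J); rewrite ?(disjoint_sym J) // JE //.
by rewrite ![J0 :|: _]setUC -[in X in parity_equiv _ X]JE -SE.
Qed.
End Derivation.
End Pairs.
Arguments idx : simpl never.
Arguments pair_of : simpl never.

(** * Signed permutation matrices acting on forms *)

Section Extmap.
Variables (K : comNzRingType) (m : nat).
Implicit Types (g : 'M[K]_m) (a b : ext K m) (S : {set 'I_m}).

Lemma extmap_evec g i : extmap g (evec K i) = \sum_j g j i *: evec K j.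
Proof. by rewrite extmap_ebase big_set1. Qed.

(** The images of the e^i are linear forms, so they satisfy the relations of the
    exterior algebra over any base ring; the complex case serves for Omega. *)
Lemma extmap_mul g : {morph extmap g : a b / a * b}.
Proof.
pose v i : ext K m := \sum_j g j i *: evec K j.
have v1 i : homogeneous 1 (v i).
  by apply: homogeneous_sum => j; apply/homogeneousZ/homogeneous_evec.
have vv0 i : v i * v i = 0 by apply: linear_form_sq0.
have vC i j : v i * v j = - (v j * v i) by apply: linear_form_anticomm.
move=> a b; rewrite [a * b]/(wedge a b) /wedge linear_sum /= {2 3}/extmap.
rewrite mulr_suml; apply: eq_bigr => I _.
rewrite linear_sum mulr_sumr; apply: eq_bigr => J _ /=.
rewrite linearZ /= -scalerAl -scalerAr scalerA (mul_prod vv0 vC) /wedge_base.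
case: ifP => _; last by rewrite linear0.
rewrite linearZ /= extmap_ebase -(signr_odd K) -(signr_odd (ext K m)).
by rewrite scaler_sign mulr_sign.
Qed.

Lemma extmap_prod g (T : Type) (r : seq T) (F : T -> ext K m) :
  extmap g (\prod_(t <- r) F t) = \prod_(t <- r) extmap g (F t).
Proof. exact: (big_morph _ (@extmap_mul g) (extmap1 g)). Qed.

Definition sgperm_mx (s : 'I_m -> bool) (sigma : 'I_m -> 'I_m) : 'M[K]_m :=
  \matrix_(j, i) ((-1) ^+ s i *+ (j == sigma i)).

Section SignedPermutation.
Variables (s : 'I_m -> bool) (sigma : 'I_m -> 'I_m).

Lemma extmap_sgperm_evec i :
  extmap (sgperm_mx s sigma) (evec K i) = (-1) ^+ s i *: evec K (sigma i).
Proof.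
rewrite extmap_evec (bigD1 (sigma i)) //= mxE eqxx big1 ?addr0 // => j ji.
by rewrite mxE (negPf ji) scale0r.
Qed.

Lemma sgperm_mx_orthogonal : injective sigma ->
  (sgperm_mx s sigma)^T *m sgperm_mx s sigma = 1%:M.
Proof.
move=> sigma_inj; apply/matrixP => i j; rewrite !mxE.
rewrite (bigD1 (sigma j)) //= big1 ?addr0 => [|k kj]; last first.
  by rewrite !mxE (negPf kj) mulr0.
rewrite !mxE eqxx (inj_eq sigma_inj) eq_sym mulr1n.
by case: eqVneq => [->|_]; rewrite ?mul0r // -signr_addb addbb.
Qed.

(** A signed permutation maps basis forms to basis forms up to sign, so it relates
    the coefficients of a form and of its image one by one. *)
Lemma extmap_sgperm_coef a S : injective sigma ->
  exists e : bool,
    extmap (sgperm_mx s sigma) a (sigma @: S) = (-1) ^+ e * a S.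
Proof.
move=> sigma_inj.
have baseE I : exists e : bool,
    extmap (sgperm_mx s sigma) (ebase K I) = (-1) ^+ e *: ebase K (sigma @: I).
  have [e ->] := ebase_prod K I; rewrite linearZ /= extmap_prod.
  under eq_bigr do rewrite extmap_sgperm_evec.
  rewrite scaler_prod -(big_map sigma xpredT (@evec K m)).
  have uI : uniq (map sigma (enum I)) by rewrite map_inj_uniq ?enum_uniq.
  have [d ->] : exists d : bool, \prod_(i <- enum I) (-1) ^+ s i = (-1) ^+ d :> K.
    apply: (big_ind (fun x : K => exists d : bool, x = (-1) ^+ d)).
    - by exists false.
    - by move=> _ _ [d ->] [d' ->]; exists (d (+) d'); rewrite signr_addb.
    - by move=> i _; exists (s i).
  have [e' ->] := prod_evec K uI; rewrite !scalerA.
  rewrite -!signr_addb; eexists; congr (_ *: ebase K _).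
  apply/setP => i; rewrite inE; apply/mapP/imsetP => -[j jI ->]; exists j => //.
    by rewrite mem_enum in jI.
  by rewrite mem_enum.
have [e SE] := baseE S; exists e.
rewrite {1}(extE a) linear_sum ext_sum (bigD1 S) //= linearZ extZ /= SE.
rewrite extZ ffunE eqxx mulr1 mulrC [X in _ + X]big1 ?addr0 // => I nI.
have [e' IE] := baseE I; rewrite linearZ extZ /= IE extZ ffunE.
by rewrite (inj_eq (imset_inj sigma_inj)) eq_sym (negPf nI) !mulr0.
Qed.

Lemma extmap_diag_coef a S : sigma =1 id ->
  extmap (sgperm_mx s sigma) a S = (\prod_(i in S) (-1) ^+ s i) * a S.
Proof.
move=> sigma1.
have baseE I : extmap (sgperm_mx s sigma) (ebase K I) =
    (\prod_(i in I) (-1) ^+ s i) *: ebase K I.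
  have [e ->] := ebase_prod K I; rewrite linearZ /= extmap_prod.
  under eq_bigr do rewrite extmap_sgperm_evec sigma1.
  by rewrite scaler_prod !scalerA mulrC big_enum.
rewrite {1}(extE a) linear_sum ext_sum (bigD1 S) //= linearZ extZ /= baseE.
rewrite extZ ffunE eqxx mulr1 mulrC [X in _ + X]big1 ?addr0 // => I nI.
by rewrite linearZ extZ /= baseE extZ ffunE eq_sym (negPf nI) !mulr0.
Qed.
End SignedPermutation.
End Extmap.

(** * Monomial elements of SU(n) *)

Section SpecialUnitary.
Variables (R : realType) (n : nat).
Implicit Types (k l : 'I_n) (i : 'I_(2 * n)) (S : {set 'I_(2 * n)}) (a : ext R (2 * n)).
Local Notation C := R[i].

Definition dz k : ext C (2 * n) :=
  evec C (idx k false) + 'i%C *: evec C (idx k true).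

Lemma Omega_formE : Omega_form R n = \prod_k dz k.
Proof. by []. Qed.

Lemma F_formE : F_form R n = \sum_k evec R (idx k false) * evec R (idx k true).
Proof. by []. Qed.

Section Monomial.
Variables (t q : 'I_n -> bool) (tau : 'I_n -> 'I_n).

(** On complex coordinates, z_k |-> (-1)^(t k) (-i)^(q k) z_(tau k): if [q k] holds,
    x + iy |-> y - ix exchanges the two members of the pair and changes one sign. *)
Definition monomial_sign i := t (pair_of i) (+) (odd i && q (pair_of i)).
Definition monomial_idx i := idx (tau (pair_of i)) (odd i (+) q (pair_of i)).
Definition monomial_mx (K : comNzRingType) : 'M[K]_(2 * n) :=
  sgperm_mx K monomial_sign monomial_idx.

Lemma extmap_monomial_evec (K : comNzRingType) k b :
  extmap (monomial_mx K) (evec K (idx k b)) =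
  (-1) ^+ (t k (+) (b && q k)) *: evec K (idx (tau k) (b (+) q k)).
Proof.
by rewrite extmap_sgperm_evec /monomial_sign /monomial_idx pair_of_idx odd_idx.
Qed.

Lemma monomial_idx_inj : injective tau -> injective monomial_idx.
Proof.
move=> tau_inj i j /idx_inj[/tau_inj pij].
rewrite pij => /(can_inj (addbK _)) oij.
by rewrite -(idx_pair_of i) pij oij idx_pair_of.
Qed.

Lemma map_monomial_mx : map_mx (real_complex R) (monomial_mx R) = monomial_mx C.
Proof. by apply/matrixP => i j; rewrite !mxE rmorphMn rmorph_sign. Qed.

Lemma extmap_monomial_dz k :
  extmap (monomial_mx C) (dz k) =
  ((-1) ^+ t k * (- 'i%C) ^+ q k) *: dz (tau k).
Proof.
rewrite /dz linearD linearZ /= !extmap_monomial_evec.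
case: (q k); rewrite ?addbF ?addbT ?expr0 ?expr1 ?mulr1 /=; last first.
  by rewrite scalerDr !scalerA mulrC.
rewrite scalerDr !scalerA addrC signrN !mulrN mulNr -mulrA -expr2 sqr_i.
by rewrite mulrN1 opprK mulrC.
Qed.

(** Orthogonality and the invariance of F hold as soon as tau is injective, so only the
    determinant condition remains. *)
Lemma monomial_special_unitary : injective tau ->
  \prod_k (((-1) ^+ t k * (- 'i%C) ^+ q k) *: dz (tau k)) = Omega_form R n ->
  special_unitary (monomial_mx R).
Proof.
move=> tau_inj tauOmega; split.
- exact/sgperm_mx_orthogonal/monomial_idx_inj.
- rewrite F_formE linear_sum [RHS](reindex_inj tau_inj) /=.
  apply: eq_bigr => k _; rewrite extmap_mul !extmap_monomial_evec /=.
  rewrite -scalerAl -scalerAr scalerA -signr_addb.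
  case: (q k); rewrite ?addbF ?addbb ?scale1r //= addbT addbN addbb /=.
  by rewrite expr1 scaleN1r [RHS]evec_anticomm.
- rewrite map_monomial_mx Omega_formE extmap_prod -[RHS]tauOmega.
  by apply: eq_bigr => k _; rewrite extmap_monomial_dz.
Qed.

Lemma invariant_monomial_coef a S : injective tau ->
  \prod_k (((-1) ^+ t k * (- 'i%C) ^+ q k) *: dz (tau k)) = Omega_form R n ->
  a \in @SU_invariant R n -> a (monomial_idx @: S) = 0 -> a S = 0.
Proof.
move=> tau_inj tauOmega /SU_invariantP inva.
have [e] := extmap_sgperm_coef monomial_sign a S (monomial_idx_inj tau_inj).
rewrite inva; last exact: monomial_special_unitary.
move=> -> /eqP; rewrite mulf_eq0 signr_eq0 => /eqP //.
Qed.

End Monomial.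

(** Otherwise the change of sign of z_k and z_l maps e^S to its opposite. *)
Lemma invariant_parity a S k l : a \in @SU_invariant R n -> a S != 0 ->
  odd (occupancy S k) = odd (occupancy S l).
Proof.
move=> /SU_invariantP inva; apply: contraNeq => oddkl; apply/eqP.
pose t j := (j == k) (+) (j == l); pose q (j : 'I_n) := false.
have prodt (K : comPzRingType) (o : 'I_n -> nat) :
    \prod_j ((-1) ^+ t j) ^+ o j = (-1) ^+ (odd (o k) (+) odd (o l)) :> K.
  have prod1 h : \prod_j ((-1) ^+ (j == h)) ^+ o j = (-1) ^+ odd (o h) :> K.
    rewrite (bigD1 h) //= eqxx expr1 big1 ?mulr1 ?signr_odd // => j /negPf->.
    by rewrite expr1n.
  rewrite signr_addb -!prod1 -big_split; apply: eq_bigr => j _ /=.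
  by rewrite signr_addb exprMn.
have /inva/ffunP/(_ S) : special_unitary (monomial_mx t q id R).
  apply: monomial_special_unitary => //.
  rewrite scaler_prod; under eq_bigr do rewrite expr0 mulr1.
  rewrite -Omega_formE.
  have := prodt C (fun=> 1%N); rewrite addbb expr0.
  under eq_bigr do rewrite expr1.
  by move=> ->; rewrite scale1r.
rewrite extmap_diag_coef => [|i]; last first.
  by rewrite /monomial_idx addbF idx_pair_of.
under eq_bigr do rewrite /monomial_sign andbF addbF.
rewrite (prod_pair_of (fun k => (-1) ^+ t k)) prodt.
rewrite addbC -negb_eqb eq_sym oddkl expr1 mulN1r => /eqP.
by rewrite eq_sym -subr_eq0 opprK -mulr2n mulrn_eq0 => /eqP.
Qed.

(** The index sets with exactly one element in each pair: the second one is chosen in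
    the k-th pair when [c k] holds. *)
Definition pair_section (c : 'I_n -> bool) : {set 'I_(2 * n)} :=
  [set i : 'I_(2 * n) | odd i == c (pair_of i)].

(** Multiplying an even number 2m of coordinates by -i has determinant (-1)^m, which a
    change of sign of the k-th coordinate compensates if m is odd. *)
Lemma invariant_pair_section a (c q : 'I_n -> bool) k :
  ~~ odd (\sum_j q j)%N -> a \in @SU_invariant R n ->
  a (pair_section (fun j => c j (+) q j)) = 0 -> a (pair_section c) = 0.
Proof.
move=> evenq inva; pose e := odd (\sum_j q j)%N./2.
pose t j := (j == k) && e.
suff <- : monomial_idx q id @: pair_section c = pair_section (fun j => c j (+) q j).
  apply: (invariant_monomial_coef (t := t)) => //.
  rewrite scaler_prod -Omega_formE big_split /=.
  rewrite (bigD1 k) //= big1 ?mulr1 => [|j /negPf jk]; last by rewrite /t jk.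
  rewrite /t eqxx /= -expr_sum -[(\sum_j q j)%N]odd_double_half (negPf evenq).
  by rewrite -mul2n exprM sqrrN sqr_i /e signr_odd -exprMn mulrNN mulr1 expr1n scale1r.
apply/setP => i; rewrite inE; apply/imsetP/idP => [[j]|/eqP oi].
  rewrite inE => /eqP oj ->; by rewrite pair_of_idx odd_idx oj.
exists (idx (pair_of i) (c (pair_of i))).
  by rewrite inE odd_idx pair_of_idx.
by rewrite /monomial_idx odd_idx pair_of_idx -oi idx_pair_of.
Qed.
End SpecialUnitary.

(** * Real and imaginary parts of complex forms *)

Section RealAndImaginaryParts.
Variables (R : rcfType) (m : nat).
Implicit Types (a b c d : ext R m).

Definition cplx_form a b : ext R[i] m :=
  ext_complex a + 'i%C *: ext_complex b.

Lemma cplx_formE a b S : cplx_form a b S = (a S +i* b S)%C.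
Proof.
rewrite extD extZ !ext_complexE; apply/eqP; rewrite eq_complex /=.
by rewrite !(mul0r, mulr0, mul1r, subr0, addr0, add0r) !eqxx.
Qed.

Lemma Re_cplx_form a b : Re_form (cplx_form a b) = a.
Proof. by apply/ffunP => S; rewrite ffunE cplx_formE. Qed.

Lemma Im_cplx_form a b : Im_form (cplx_form a b) = b.
Proof. by apply/ffunP => S; rewrite ffunE cplx_formE. Qed.

Lemma cplx_form_inj a b c d : cplx_form a b = cplx_form c d -> a = c /\ b = d.
Proof.
move=> e; split; first by rewrite -(Re_cplx_form a b) e Re_cplx_form.
by rewrite -(Im_cplx_form a b) e Im_cplx_form.
Qed.

Lemma cplx_form0 : cplx_form 0 0 = 0.
Proof. by rewrite /cplx_form ext_complex0 scaler0 addr0. Qed.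

Lemma ext_complexN a : ext_complex (- a) = - ext_complex a.
Proof. by rewrite -scaleN1r ext_complexZ rmorphN1 scaleN1r. Qed.

Lemma cplx_formN a b : - cplx_form a b = cplx_form (- a) (- b).
Proof. by rewrite /cplx_form !ext_complexN scalerN opprD. Qed.

Lemma cplx_formM a b c d :
  cplx_form a b * cplx_form c d = cplx_form (a * c - b * d) (a * d + b * c).
Proof.
rewrite /cplx_form !ext_complexD ext_complexN !ext_complexM mulrDl !mulrDr.
rewrite -!scalerAl -!scalerAr scalerA -expr2 sqr_i scaleN1r scalerDr.
by rewrite [X in _ + X = _]addrC addrACA.
Qed.

Lemma cplx_form_conjM a b c d :
  cplx_form a (- b) * cplx_form c (- d) =
  cplx_form (a * c - b * d) (- (a * d + b * c)).
Proof. by rewrite cplx_formM (mulrNN b d) (mulrN a d) (mulNr b c) -opprD. Qed.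

Lemma cplx_formD a b c d :
  cplx_form a b + cplx_form c d = cplx_form (a + c) (b + d).
Proof. by rewrite /cplx_form !ext_complexD scalerDr addrACA. Qed.

Lemma cplx_form_realMl a c d :
  cplx_form a 0 * cplx_form c d = cplx_form (a * c) (a * d).
Proof. by rewrite cplx_formM !mul0r subr0 addr0. Qed.

Lemma cplx_form_real_comm a c d : GRing.comm a c -> GRing.comm a d ->
  GRing.comm (cplx_form a 0) (cplx_form c d).
Proof.
move=> ac ad; rewrite /GRing.comm [LHS]cplx_form_realMl [RHS]cplx_formM ac ad.
by rewrite !mulr0 subr0 add0r.
Qed.

(** The scalar identity - (2i)^3 = 8i. *)
Lemma cplx_form_im_prod3 a b c :
  - (cplx_form 0 (2%:R *: a) * cplx_form 0 (2%:R *: b) * cplx_form 0 (2%:R *: c)) =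
  cplx_form 0 (8%:R *: (a * b * c)).
Proof.
rewrite [cplx_form 0 _ * cplx_form 0 _]cplx_formM !(mul0r, mulr0) sub0r addr0.
rewrite cplx_form_realMl cplx_formN mulr0 oppr0 mulNr opprK.
by rewrite -!(scalerAl, scalerAr) !scalerA -!natrM.
Qed.

Lemma homogeneous_Re p (z : ext R[i] m) : homogeneous p z -> homogeneous p (Re_form z).
Proof. by move=> hz S nS; rewrite ffunE hz. Qed.

Lemma homogeneous_Im p (z : ext R[i] m) : homogeneous p z -> homogeneous p (Im_form z).
Proof. by move=> hz S nS; rewrite ffunE hz. Qed.

End RealAndImaginaryParts.

(** The hypotheses are the real and imaginary parts of (a + ib)^2 = 0 and
    (a - ib)(a + ib) = 8iv. *)
Lemma conjugate_square_relations (K : numFieldType) (A : lalgType K) (a b v : A) :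
    a * a - b * b = 0 -> a * b + b * a = 0 ->
    a * a + b * b = 0 -> a * b - b * a = 8%:R *: v ->
  [/\ a * a = 0, b * b = 0, a * b = 4%:R *: v & b * a = - (4%:R *: v)].
Proof.
have half0 (x : A) : x *+ 2 = 0 -> x = 0.
  by move/eqP; rewrite -scaler_nat scaler_eq0 pnatr_eq0 => /eqP.
move=> /eqP; rewrite subr_eq0 => /eqP abE /eqP; rewrite addr_eq0 => /eqP ba.
rewrite abE -mulr2n => /half0 b0 ab8.
have ab : a * b = 4%:R *: v.
  apply/eqP; rewrite -subr_eq0; apply/eqP/half0.
  have -> : (a * b - 4%:R *: v) *+ 2 = a * b + a * b - 8%:R *: v.
    by rewrite mulrnBl mulr2n -[(_ *: v) *+ 2]scaler_nat scalerA -natrM.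
  by rewrite {2}ba ab8 subrr.
by split=> //; rewrite -ab ba opprK.
Qed.

Section Products.
Variables (R : realType) (n : nat).
Implicit Types (k : 'I_n).

Definition dxdy (k : 'I_n) : ext R (2 * n) :=
  evec R (idx k false) * evec R (idx k true).

Definition dz_conj k : ext R[i] (2 * n) :=
  cplx_form (evec R (idx k false)) (- evec R (idx k true)).

Lemma dzE k : dz R k = cplx_form (evec R (idx k false)) (evec R (idx k true)).
Proof. by rewrite /cplx_form !ext_complex_ebase. Qed.

Lemma homogeneous_dz k : homogeneous 1 (dz R k).
Proof.
by apply: homogeneousD; [|apply: homogeneousZ]; apply: homogeneous_evec.
Qed.

Lemma homogeneous_dz_conj k : homogeneous 1 (dz_conj k).
Proof.
apply: homogeneousD; [|apply: homogeneousZ]; last rewrite -scaleN1r ext_complexZ.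
  by rewrite ext_complex_ebase; apply: homogeneous_evec.
by rewrite ext_complex_ebase; apply/homogeneousZ/homogeneous_evec.
Qed.

Lemma homogeneous_F : homogeneous 2 (F_form R n).
Proof.
by apply: homogeneous_sum => k; apply: (@homogeneousM _ _ 1 1); apply: homogeneous_evec.
Qed.

Lemma homogeneous_Omega : homogeneous n (Omega_form R n).
Proof.
have szI : size (index_enum 'I_n) = n by rewrite /index_enum unlock -enumT size_enum_ord.
by rewrite -[X in homogeneous X]szI; exact/homogeneous_prod/homogeneous_dz.
Qed.

Lemma Omega_cplx : Omega_form R n = cplx_form (Omegap_form R n) (Omegam_form R n).
Proof.
apply/ffunP => S; rewrite cplx_formE !ffunE.
by case: (Omega_form R n S).
Qed.

(** A product of complex forms and the product of their conjugates have the same real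
    parts and opposite imaginary parts. *)
Lemma Omega_conj :
  \prod_k dz_conj k = cplx_form (Omegap_form R n) (- Omegam_form R n).
Proof.
pose P (z w : ext R[i] (2 * n)) :=
  exists a b, z = cplx_form a b /\ w = cplx_form a (- b).
have [a [b [abE ->]]] : P (Omega_form R n) (\prod_k dz_conj k).
  rewrite Omega_formE; apply: (big_ind2 P).
  - exists 1, 0; rewrite oppr0 /cplx_form.
    by rewrite ext_complex1 ext_complex0 scaler0 addr0.
  - move=> _ z' _ w' [a [b [-> ->]]] [c [d [-> ->]]].
    exists (a * c - b * d), (a * d + b * c).
    by split; [exact: cplx_formM|exact: cplx_form_conjM].
  - by move=> k _; exists (evec R (idx k false)), (evec R (idx k true)); rewrite dzE.
by rewrite Omega_cplx in abE; case/cplx_form_inj: abE => -> ->.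
Qed.

Lemma dxdy_comm k v : homogeneous 1 v -> GRing.comm (dxdy k) v.
Proof.
move=> hv; rewrite /GRing.comm /dxdy -mulrA.
rewrite (linear_form_anticomm (@homogeneous_evec _ _ _) hv) mulrN mulrA mulrA.
by rewrite (linear_form_anticomm (@homogeneous_evec _ _ _) hv) mulNr opprK.
Qed.

Lemma dxdy_sq0 k : dxdy k * dxdy k = 0.
Proof.
rewrite /dxdy mulrA -[_ * _ * evec _ (idx k false)]mulrA.
by rewrite [evec _ (idx k true) * evec _ _]evec_anticomm mulrN mulrA evec_sq0
  mul0r oppr0 mul0r.
Qed.

Lemma dxdy_dz k : cplx_form (dxdy k) 0 * dz R k = 0.
Proof.
rewrite dzE cplx_formM !mul0r subr0 addr0 /dxdy.
rewrite -[X in cplx_form _ X]mulrA evec_sq0 mulr0 -mulrA.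
by rewrite [evec _ (idx k true) * _]evec_anticomm mulrN mulrA evec_sq0 mul0r oppr0 cplx_form0.
Qed.

Lemma dz_conj_dz k : dz_conj k * dz R k = cplx_form 0 (2%:R *: dxdy k).
Proof.
rewrite dzE cplx_formM !mulNr !evec_sq0 oppr0 subr0; congr cplx_form.
by rewrite [X in _ - X]evec_anticomm opprK scaler_nat mulr2n.
Qed.
End Products.

(** * Invariants of degree 3 and 4 for n = 3 *)

Definition pair1 : 'I_3 := @Ordinal 3 0 isT.
Definition pair2 : 'I_3 := @Ordinal 3 1 isT.
Definition pair3 : 'I_3 := @Ordinal 3 2 isT.

Lemma big_ord3 (T : Type) (x0 : T) (op : Monoid.law x0) (F : 'I_3 -> T) :
  \big[op/x0]_k F k = op (F pair1) (op (F pair2) (F pair3)).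
Proof.
rewrite !big_ord_recl big_ord0 Monoid.mulm1.
by congr (op (F _) (op (F _) (F _))); apply: val_inj.
Qed.

Lemma sum_ord3 (V : nmodType) (F : 'I_3 -> V) :
  \sum_k F k = F pair1 + (F pair2 + F pair3).
Proof. exact: big_ord3. Qed.

Lemma prod_ord3 (A : pzSemiRingType) (F : 'I_3 -> A) :
  \prod_k F k = F pair1 * (F pair2 * F pair3).
Proof. exact: big_ord3. Qed.

Lemma ord3P (P : 'I_3 -> Prop) : P pair1 -> P pair2 -> P pair3 -> forall k, P k.
Proof.
move=> P1 P2 P3 [[|[|[|//]]] k3].
- by rewrite (_ : Ordinal k3 = pair1) //; apply: val_inj.
- by rewrite (_ : Ordinal k3 = pair2) //; apply: val_inj.
- by rewrite (_ : Ordinal k3 = pair3) //; apply: val_inj.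
Qed.

Section Anticommuting.
Variable A : pzRingType.
Implicit Types (a b c u v w x y z : A).

Lemma mul3_rot u v w : v * u = - (u * v) -> w * u = - (u * w) ->
  v * (w * u) = u * (v * w).
Proof. by move=> vu wu; rewrite wu mulrN mulrA vu mulNr opprK mulrA. Qed.

Lemma mul3_sq0 u v w : v * u = - (u * v) -> w * u = - (u * w) -> u * u = 0 ->
  (u * (v * w)) * (u * (v * w)) = 0.
Proof.
move=> vu wu uu; rewrite -!mulrA [w * (u * _)]mulrA wu mulNr -!mulrA !mulrN.
by rewrite [v * (u * _)]mulrA vu mulNr -!mulrA !mulrN opprK mulrA uu mul0r.
Qed.

(** Reordering uvwxyz as uxvywz takes three transpositions, whence the sign. *)
Lemma mul3_zip u v w x y z a b c :
    w * x = - (x * w) -> v * x = - (x * v) -> w * y = - (y * w) ->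
    u * x = a -> v * y = b -> w * z = c ->
  (u * (v * w)) * (x * (y * z)) = - (a * b * c).
Proof.
move=> wx vx wy <- <- <-; rewrite -!mulrA [w * (x * _)]mulrA wx mulNr -!mulrA !mulrN.
rewrite [v * (x * _)]mulrA vx mulNr -!mulrA !mulrN opprK.
by rewrite [w * (y * _)]mulrA wy mulNr -!mulrA !mulrN.
Qed.

Lemma comm_mul3_eq0 x u v w : GRing.comm x u -> GRing.comm x v ->
  [\/ x * u = 0, x * v = 0 | x * w = 0] -> x * (u * (v * w)) = 0.
Proof.
move=> xu xv; case=> x0; rewrite mulrA ?x0 ?mul0r // xu -mulrA [x * _]mulrA.
  by rewrite x0 mul0r mulr0.
by rewrite xv -mulrA x0 !mulr0.
Qed.

Lemma cube_sum3 x y z : x * x = 0 -> y * y = 0 -> z * z = 0 ->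
    y * x = x * y -> z * x = x * z -> z * y = y * z ->
  (x + (y + z)) ^+ 3 = (x * y * z) *+ 6.
Proof.
move=> xx yy zz yx zx zy.
have sq : (x + (y + z)) ^+ 2 = (x * y + (x * z + y * z)) *+ 2.
  rewrite expr2 !mulrDl !mulrDr xx yy zz yx zx zy !add0r !addr0 mulr2n.
  by rewrite (AC (2*(2*2)) ((1*(2*4))*(3*(5*6)))).
have xyx : x * y * x = 0 by rewrite -mulrA yx mulrA xx mul0r.
have xyy : x * y * y = 0 by rewrite -mulrA yy mulr0.
have xzx : x * z * x = 0 by rewrite -mulrA zx mulrA xx mul0r.
have xzy : x * z * y = x * y * z by rewrite -mulrA zy mulrA.
have xzz : x * z * z = 0 by rewrite -mulrA zz mulr0.
have yzx : y * z * x = x * y * z by rewrite -mulrA zx mulrA yx.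
have yzy : y * z * y = 0 by rewrite -mulrA zy mulrA yy mul0r.
have yzz : y * z * z = 0 by rewrite -mulrA zz mulr0.
rewrite exprSr sq mulrnAl !mulrDl !mulrDr xyx xyy xzx xzy xzz yzx yzy yzz.
by rewrite !add0r !addr0 -mulr2n -mulrS -mulrnA.
Qed.
End Anticommuting.

Section Degree3.
Variable R : realType.
Implicit Types (a : ext R (2 * 3)) (S : {set 'I_(2 * 3)}) (k : 'I_3).

Lemma pair_sectionP n (S : {set 'I_(2 * n)}) : (forall k : 'I_n, occupancy S k = 1%N) ->
  S = pair_section (fun k : 'I_n => idx k true \in S).
Proof.
move=> S1; apply/setP => i; rewrite inE -(idx_pair_of i) odd_idx pair_of_idx.
have := S1 (pair_of i); rewrite /occupancy.
by case: (odd i); do 2!case: (_ \in _).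
Qed.

(** All pairs have the same parity and 3 is odd, so only sets with one element in each
    pair occur. There are eight of these, and changing an even number of choices
    brings each of them to one of the two in the hypotheses. *)
Lemma invariant_degree3_eq0 a : a \in @SU_invariant R 3 -> homogeneous 3 a ->
  a (pair_section (fun=> false)) = 0 ->
  a (pair_section (fun k => k == pair1)) = 0 -> a = 0.
Proof.
move=> inva ha a0 a1; apply: (ext_in_degree0 ha) => S S3.
have [->//|aS] := eqVneq (a S) 0.
have parS k := invariant_parity k pair1 inva aS.
have S1 k : occupancy S k = 1%N.
  have := sum_occupancy S; rewrite S3 big_ord3 /=.
  have := parS pair2; have := parS pair3; rewrite /occupancy.
  by move: k; apply: ord3P; do 6!case: (_ \in _).
have -> := pair_sectionP S1; set c := fun k => _.
(* Only the parity of the number of choices is preserved; an odd excess is put on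
   the first pair. *)
pose d := odd (\sum_k c k)%N.
apply: (invariant_pair_section (q := fun k => c k (+) ((k == pair1) && d)) pair1) => //.
  rewrite /d big_ord3 !big_ord3 /=.
  by do 3!case: (c _).
case: d.
  rewrite (_ : pair_section _ = pair_section (fun k => k == pair1)) //.
  by apply/setP => i; rewrite !inE addKb andbT.
rewrite (_ : pair_section _ = pair_section (fun=> false)) //.
by apply/setP => i; rewrite !inE addKb andbF.
Qed.

(** The sets of indices of the products of two of the three 2-forms e^{12}, e^{34},
    e^{56}. *)
Definition copair k : {set 'I_(2 * 3)} := [set i | pair_of i != k].

Lemma invariant_copair a k : a \in @SU_invariant R 3 ->
  a (copair (ordS k)) = 0 -> a (copair k) = 0.
Proof.
move=> inva.
have tau_inj : injective (@ordS 3) by exact: ordS_inj.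
suff <- : monomial_idx (fun=> false) (@ordS 3) @: copair k = copair (ordS k).
  apply: (invariant_monomial_coef (t := fun=> false)) => //.
  under eq_bigr do rewrite mul1r scale1r.
  rewrite Omega_formE [LHS]prod_ord3 [RHS]prod_ord3.
  have -> : ordS pair1 = pair2 by apply: val_inj.
  have -> : ordS pair2 = pair3 by apply: val_inj.
  have -> : ordS pair3 = pair1 by apply: val_inj.
  by apply: mul3_rot; apply: linear_form_anticomm; apply: homogeneous_dz.
apply/setP => i; rewrite inE; apply/imsetP/idP => [[j]|ik].
  by rewrite inE => jk ->; rewrite pair_of_idx (inj_eq tau_inj).
exists (idx (ord_pred (pair_of i)) (odd i)).
  by rewrite inE pair_of_idx -(inj_eq tau_inj) ord_predK.
by rewrite /monomial_idx pair_of_idx odd_idx addbF ord_predK idx_pair_of.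
Qed.

(** All pairs have the same parity and 4 is even, so two pairs are full and one is
    empty; the cyclic permutation exchanges the three possibilities. *)
Lemma invariant_degree4_eq0 a : a \in @SU_invariant R 3 -> homogeneous 4 a ->
  a (copair pair1) = 0 -> a = 0.
Proof.
move=> inva ha a1; apply: (ext_in_degree0 ha) => S S4.
have [->//|aS] := eqVneq (a S) 0.
have parS k := invariant_parity k pair1 inva aS.
have [k Sk] : exists k, S = copair k.
  have copairP k : (forall j, occupancy S j = (j != k).*2) -> S = copair k.
    move=> Sk; apply/setP => i; rewrite inE -(idx_pair_of i) pair_of_idx.
    have := Sk (pair_of i); rewrite /occupancy.
    by case: (odd i); do 2!case: (_ \in _); case: (_ != k).
  have := sum_occupancy S; rewrite S4 big_ord3 /=.
  have := parS pair2; have := parS pair3.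
  case S1 : (occupancy S pair1) (occupancy_le2 S pair1) => [|[|[|?]]] // _;
  case S2 : (occupancy S pair2) (occupancy_le2 S pair2) => [|[|[|?]]] // _;
  case S3 : (occupancy S pair3) (occupancy_le2 S pair3) => [|[|[|?]]] // _ _ _ _.
  - by exists pair1; apply: copairP; apply: ord3P.
  - by exists pair2; apply: copairP; apply: ord3P.
  - by exists pair3; apply: copairP; apply: ord3P.
have a3 : a (copair pair3) = 0.
  by apply: invariant_copair; rewrite // (_ : ordS _ = pair1) //; apply: val_inj.
rewrite Sk; move: k {Sk}; apply: ord3P => //.
by apply: invariant_copair; rewrite // (_ : ordS _ = pair3) //; apply: val_inj.
Qed.
End Degree3.

(** * Products of F, Omega^+ and Omega^- for n = 3 *)

Section Relations.
Variable R : realType.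
Local Notation F := (F_form R 3).
Local Notation Op := (Omegap_form R 3).
Local Notation Om := (Omegam_form R 3).

Definition volume : ext R (2 * 3) := dxdy R pair1 * dxdy R pair2 * dxdy R pair3.

Lemma volume_neq0 : volume != 0.
Proof.
pose r := [:: idx pair1 false; idx pair1 true; idx pair2 false; idx pair2 true;
              idx pair3 false; idx pair3 true].
have [|e re] := @prod_evec R _ r; first by [].
have -> : volume = \prod_(i <- r) evec R i.
  by rewrite /volume /dxdy !big_cons big_nil mulr1 !mulrA.
rewrite re scaler_eq0 signr_eq0 /=; apply/eqP => /ffunP/(_ [set i in r]).
by rewrite !ffunE eqxx; apply/eqP/oner_neq0.
Qed.

Lemma scale_volume_eq0 (c : R) : c *: volume = 0 -> c = 0.
Proof. by move/eqP; rewrite scaler_eq0 (negPf volume_neq0) orbF => /eqP. Qed.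

Lemma dxdy_commute k l : dxdy R k * dxdy R l = dxdy R l * dxdy R k :> ext R (2 * 3).
Proof.
rewrite {2 3}/dxdy; apply: commrM; apply: dxdy_comm; exact: homogeneous_evec.
Qed.

Lemma F_cube : F ^+ 3 = 6%:R *: volume.
Proof.
rewrite F_formE sum_ord3 scaler_nat.
apply: cube_sum3 (dxdy_sq0 _ _) (dxdy_sq0 _ _) (dxdy_sq0 _ _) _ _ _.
- exact: dxdy_commute.
- exact: dxdy_commute.
- exact: dxdy_commute.
Qed.

(** Each term of F kills Omega because (x y)(x + i y) = 0 for linear forms x and y. *)
Lemma F_Omega_eq0 : F * Op = 0 /\ F * Om = 0.
Proof.
have dzC (k j : 'I_3) : cplx_form (dxdy R k) 0 * dz R j = dz R j * cplx_form (dxdy R k) 0.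
  rewrite dzE; apply: cplx_form_real_comm; apply: dxdy_comm;
    exact: homogeneous_evec.
apply: cplx_form_inj; rewrite cplx_form0.
have -> : cplx_form (F * Op) (F * Om) = cplx_form F 0 * Omega_form R 3.
  by rewrite Omega_cplx cplx_form_realMl.
have -> : cplx_form F 0 = \sum_k cplx_form (dxdy R k) 0.
  rewrite F_formE; apply: (big_ind2 (fun x y => cplx_form x 0 = y)).
  - exact: cplx_form0.
  - by move=> x _ y _ <- <-; rewrite cplx_formD addr0.
  - by [].
rewrite Omega_formE mulr_suml big1 // => k _; rewrite prod_ord3.
apply: comm_mul3_eq0; [exact: dzC | exact: dzC |].
have := dxdy_dz R k; move: k; apply: ord3P => k0.
- by constructor 1.
- by constructor 2.
- by constructor 3.
Qed.

Lemma Omega_sq : Omega_form R 3 * Omega_form R 3 = 0.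
Proof.
rewrite Omega_formE prod_ord3; apply: mul3_sq0.
- by apply: linear_form_anticomm; apply: homogeneous_dz.
- by apply: linear_form_anticomm; apply: homogeneous_dz.
- by apply: linear_form_sq0; apply: homogeneous_dz.
Qed.

(** From (x - iy)(x + iy) = 2i xy in each coordinate. *)
Lemma Omega_conj_Omega :
  (\prod_k dz_conj R k) * Omega_form R 3 = cplx_form 0 (8%:R *: volume).
Proof.
have anti k l : dz_conj R k * dz R l = - (dz R l * dz_conj R k) :> ext R[i] (2 * 3).
  by apply: linear_form_anticomm; [apply: homogeneous_dz_conj|apply: homogeneous_dz].
rewrite Omega_formE [X in X * _]prod_ord3 [X in _ * X]prod_ord3.
rewrite (mul3_zip (anti _ _) (anti _ _) (anti _ _)
  (dz_conj_dz R _) (dz_conj_dz R _) (dz_conj_dz R _)).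
exact: cplx_form_im_prod3.
Qed.

Lemma Omegap_Omegam :
  [/\ Op * Op = 0, Om * Om = 0, Op * Om = 4%:R *: volume & Om * Op = - (4%:R *: volume)].
Proof.
have := Omega_sq; rewrite Omega_cplx cplx_formM -cplx_form0 => /cplx_form_inj[].
have := Omega_conj_Omega; rewrite Omega_conj Omega_cplx cplx_formM.
move=> /cplx_form_inj[]; rewrite !mulNr opprK => sum0 diff8 diff0 sum'0.
exact: conjugate_square_relations.
Qed.
End Relations.

(** * Spanning forms and the theorem *)

(** Cramer's rule in the plane: two functionals that are jointly injective on a
    subspace embed it in K^2, where two independent vectors have a nonzero
    determinant. This avoids computing the coefficients of Omega^+ and Omega^-. *)
Lemma two_functionals_span (K : fieldType) (V : lmodType K) (P : V -> Prop)
    (phi psi : V -> K) (u v : V) :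
    (forall x y, P x -> P y -> forall k l : K, P (k *: x + l *: y)) ->
    (forall x y (k l : K), phi (k *: x + l *: y) = k * phi x + l * phi y) ->
    (forall x y (k l : K), psi (k *: x + l *: y) = k * psi x + l * psi y) ->
    (forall x, P x -> phi x = 0 -> psi x = 0 -> x = 0) ->
    P u -> P v -> (forall k l : K, k *: u + l *: v = 0 -> k = 0 /\ l = 0) ->
  forall x, P x -> exists k l : K, x = k *: u + l *: v.
Proof.
move=> PD phiD psiD inj Pu Pv free x Px.
pose d := phi u * psi v - psi u * phi v.
have d_neq0 : d != 0.
  apply/eqP => d0.
  have [psi_v psi_u] : psi v = 0 /\ - psi u = 0.
    apply: free; apply: inj; first exact: PD.
      by rewrite phiD -d0 /d; ring.
    by rewrite psiD; ring.
  have [phi_v phi_u] : phi v = 0 /\ - phi u = 0.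
    apply: free; apply: inj; first exact: PD.
      by rewrite phiD; ring.
    by rewrite psiD -[RHS]oppr0 -d0 /d; ring.
  have u0 : u = 0 by apply: inj => //; apply/eqP; rewrite -oppr_eq0 ?phi_u ?psi_u.
  have [/eqP] : (1 : K) = 0 /\ (0 : K) = 0 by apply: free; rewrite u0 scaler0 scale0r addr0.
  by rewrite oner_eq0.
exists ((phi x * psi v - psi x * phi v) / d), ((phi u * psi x - psi u * phi x) / d).
set y := RHS; have Py : P y by apply: PD.
apply/eqP; rewrite -subr_eq0; apply/eqP.
have -> : x - y = 1 *: x + (- 1) *: y by rewrite scale1r scaleN1r.
apply: inj; first exact: PD.
  by rewrite phiD /y phiD; rewrite /d in d_neq0 *; field.
by rewrite psiD /y psiD; rewrite /d in d_neq0 *; field.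
Qed.

Section Classification.
Variable R : realType.
Local Notation F := (F_form R 3).
Local Notation Op := (Omegap_form R 3).
Local Notation Om := (Omegam_form R 3).

(** Multiplication by Omega^- and by Omega^+ isolates the two coefficients. *)
Lemma Omega_free (k l : R) : k *: Op + l *: Om = 0 -> k = 0 /\ l = 0.
Proof.
have [Opp Omm Opm Omp] := Omegap_Omegam R.
have coef0 := @scale_volume_eq0 R.
move=> kl; split; apply/eqP.
  have : (k *: Op + l *: Om) * Om = 0 by rewrite kl mul0r.
  rewrite mulrDl -!scalerAl Opm Omm scaler0 addr0 scalerA => /coef0/eqP.
  by rewrite mulf_eq0 pnatr_eq0 orbF.
have : (k *: Op + l *: Om) * Op = 0 by rewrite kl mul0r.
rewrite mulrDl -!scalerAl Opp Omp scaler0 add0r scalerN scalerA.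
move/eqP; rewrite oppr_eq0 => /eqP/coef0/eqP.
by rewrite mulf_eq0 pnatr_eq0 orbF.
Qed.

Lemma invariant_degree3 a : a \in @SU_invariant R 3 -> homogeneous 3 a ->
  exists lambda mu : R, a = lambda *: Op + mu *: Om.
Proof.
move=> inva ha.
pose P (b : ext R (2 * 3)) := b \in @SU_invariant R 3 /\ homogeneous 3 b.
apply: (@two_functionals_span R _ P (fun b => b (pair_section (fun=> false)))
  (fun b => b (pair_section (fun k => k == pair1)))) => //.
- move=> b c [ib hb] [ic hc] k l; split; first by rewrite rpredD ?rpredZ.
  by apply: homogeneousD; apply: homogeneousZ.
- by move=> b c k l; rewrite extD !extZ.
- by move=> b c k l; rewrite extD !extZ.
- by move=> b [ib hb]; exact: invariant_degree3_eq0.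
- by split; [exact: Omegap_invariant|exact/homogeneous_Re/homogeneous_Omega].
- by split; [exact: Omegam_invariant|exact/homogeneous_Im/homogeneous_Omega].
- exact: Omega_free.
Qed.

Lemma F_sq_invariant : F ^+ 2 \in @SU_invariant R 3.
Proof. by rewrite rpredX // F_invariant. Qed.

Lemma homogeneous_F_sq : homogeneous 4 (F ^+ 2).
Proof. by rewrite expr2; apply: (@homogeneousM _ _ 2 2); apply: homogeneous_F. Qed.

(** F^2 does not vanish because F^3 does not, so by injectivity neither does its
    coefficient that determines invariants of degree 4. *)
Lemma invariant_degree4 a : a \in @SU_invariant R 3 -> homogeneous 4 a ->
  exists c : R, a = c *: F ^+ 2.
Proof.
move=> inva ha; pose S := copair pair1.
have F2_neq0 : (F ^+ 2) S != 0.
  apply: contra_neq (volume_neq0 R) => F2S.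
  have /eqP := F_cube R; rewrite exprSr.
  rewrite (invariant_degree4_eq0 F_sq_invariant homogeneous_F_sq F2S) mul0r eq_sym.
  by rewrite scaler_eq0 pnatr_eq0 => /eqP.
exists (a S / (F ^+ 2) S); apply/eqP; rewrite -subr_eq0; apply/eqP.
apply: invariant_degree4_eq0.
- by rewrite rpredB ?rpredZ ?F_sq_invariant.
- rewrite -scaleN1r; apply: homogeneousD ha _.
  exact/homogeneousZ/homogeneousZ/homogeneous_F_sq.
- by rewrite -scaleN1r extD !extZ -/S mulfVK ?mulN1r ?subrr.
Qed.
End Classification.

Theorem proposition18 (R : realType) (n : nat) (hn : (2 <= n)%N)
  (f : {linear SUform R n -> SUform R n})
  (hf : differential_operator (@SUhomogeneous R n) f)
  (hext : exists2 D : {linear ext R (2 * n) -> ext R (2 * n)},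
      derivation_degree1 (@homogeneous R (2 * n)) D &
      forall a : SUform R n, D (SUform_val a) = SUform_val (f a)) :
  (forall a : SUform R n, f a = 0) \/
  (n = 3%N /\
   exists lambda mu : R,
     [/\ f (SU_F R n) = lambda *: SU_Omegap R n + mu *: SU_Omegam R n,
         f (SU_Omegap R n) = (2%:R / 3%:R * mu) *: SU_F R n ^+ 2 &
         f (SU_Omegam R n) = - (2%:R / 3%:R * lambda) *: SU_F R n ^+ 2]).
Proof.
have [n3|/eqP n3] := eqVneq n 3%N; last first.
  left=> a; case: hext => D derD Df.
  apply/val_inj/ffunP => S /=; rewrite -Df [RHS]ffunE.
  have inva := SUform_invariant a; have invfa := SUform_invariant (f a).
  have [//|DaS] := eqVneq (D (SUform_val a) S) 0.
  rewrite [SUform_val a]extE linear_sum ext_sum big1 // => I _.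
  rewrite linearZ extZ /=; have [->|aI] := eqVneq (SUform_val a I) 0.
    by rewrite mul0r.
  rewrite (derivation_parity_shift derD) ?mulr0 // => k l.
  (* e^I occurs in a and e^S in f a; both are invariant, so the parity vectors of I
     and S are constant. *)
  rewrite (oddD (occupancy I k)) (oddD (occupancy I l)) (invariant_parity k l inva aI).
  by rewrite (invariant_parity (S := S) k l invfa) // -Df.
right; split=> //; subst n; case: hf => -[degf leibf] _ {hext hn}.
have homF : SUhomogeneous 2 (SU_F R 3) by exact: homogeneous_F.
have homOp : SUhomogeneous 3 (SU_Omegap R 3) by exact/homogeneous_Re/homogeneous_Omega.
have homOm : SUhomogeneous 3 (SU_Omegam R 3) by exact/homogeneous_Im/homogeneous_Omega.
have [lambda [mu fF]] :=
  invariant_degree3 (SUform_invariant (f (SU_F R 3))) (degf _ _ homF).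
have [p fOp] := invariant_degree4 (SUform_invariant (f (SU_Omegap R 3))) (degf _ _ homOp).
have [q fOm] := invariant_degree4 (SUform_invariant (f (SU_Omegam R 3))) (degf _ _ homOm).
have coef0 := @scale_volume_eq0 R.
have [FOp FOm] := F_Omega_eq0 R.
have [Opp Omm Opm Omp] := Omegap_Omegam R.
have leib a : F_form R 3 * SUform_val a = 0 ->
    SUform_val (f (SU_F R 3)) * SUform_val a + F_form R 3 * SUform_val (f a) = 0.
  move=> Fa0; have := leibf 2%N (SU_F R 3) a homF.
  have -> : SU_F R 3 * a = 0 by exact: val_inj.
  by rewrite linear0 sqrrN expr1n mul1r => /(congr1 (@SUform_val R 3))/esym.
have p_mu : p = 2%:R / 3%:R * mu.
  have := leib (SU_Omegap R 3) FOp; rewrite fF fOp.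
  rewrite mulrDl -!scalerAl [SUform_val _]/= Opp Omp scaler0 add0r -scalerAr -exprS F_cube.
  rewrite scalerN scalerA scalerA -scaleNr -scalerDl => /coef0 pmu0.
  by lra.
have q_lambda : q = - (2%:R / 3%:R * lambda).
  have := leib (SU_Omegam R 3) FOm; rewrite fF fOm.
  rewrite mulrDl -!scalerAl [SUform_val _]/= Opm Omm scaler0 addr0 -scalerAr -exprS F_cube.
  by rewrite !scalerA -scalerDl => /coef0 qlambda0; lra.
exists lambda, mu; rewrite -p_mu -q_lambda.
by split; apply: val_inj; rewrite /= ?fF ?fOp ?fOm.
Qed.
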